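(* A monoid $M$ is quasi-atomic if and only if every nonempty prime ideal of $M$ contains an atom of $M$.
   Context: A monoid is a cancellative, commutative semigroup with identity, written additively (identity $0$). For a monoid $M$, $\mathcal{U}(M)$ is the group of invertible elements. For $S\subseteq M$, $\langle S\rangle$ is the smallest submonoid of $M$ containing $S$. An element $a\in M\setminus\mathcal{U}(M)$ is an atom if whenever $a=r+s$ with $r,s\in M$, either $r\in\mathcal{U}(M)$ or $s\in\mathcal{U}(M)$; $\mathcal{A}(M)$ is the set of atoms. A non-invertible element $b\in M$ is quasi-atomic if there exists $m\in M$ such that $b+m\in\langle\mathcal{A}(M)\rangle$. $M$ is quasi-atomic if every non-invertible element of $M$ is quasi-atomic. A subset $I\subseteq M$ is an ideal if $I+M\subseteq I$, where $I+M=\{r+s : r\in I,\ s\in M\}$; it is proper if $I\neq M$. A proper ideal $P$ is prime if whenever $r,s\in M$ and $r+s\in P$, then $r\in P$ or $s\in P$. *)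

(* Defs.v *)
From mathcomp Require Import all_boot all_algebra.
From mathcomp Require Import boolp classical_sets.

Set Implicit Arguments.
Unset Strict Implicit.
Unset Printing Implicit Defensive.

Import GRing.Theory.

Local Open Scope classical_set_scope.
Local Open Scope ring_scope.

Section QuasiAtomic.
Variable M : nmodType.
Implicit Types (a b m r s u x y : M) (I P S : set M).

(* With commutativity, one-sided cancellation suffices. *)
Definition cancellative : Prop := right_injective (@GRing.add M).

Definition invertible : set M := [set u | exists v : M, u + v = 0].

Definition is_submonoid S : Prop :=
  S 0 /\ forall x y, S x -> S y -> S (x + y).

Definition gen_submonoid S : set M := smallest is_submonoid S.

Definition is_atom a : Prop :=
  ~ invertible a /\
  forall r s, a = r + s -> invertible r \/ invertible s.

Definition atoms : set M := [set a | is_atom a].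

Definition quasi_atomic_elt b : Prop :=
  ~ invertible b /\ exists m, gen_submonoid atoms (b + m).

Definition quasi_atomic : Prop :=
  forall b, ~ invertible b -> quasi_atomic_elt b.

(* The empty set is an ideal, and it is prime. *)
Definition is_ideal I : Prop :=
  [set r + s | r in I & s in [set: M]] `<=` I.

Definition is_prime_ideal P : Prop :=
  [/\ is_ideal P, P <> [set: M] &
      forall r s, P (r + s) -> P r \/ P s].

End QuasiAtomic.

Arguments cancellative M : clear implicits.
Arguments quasi_atomic M : clear implicits.
Arguments atoms M : clear implicits.
Arguments invertible M : clear implicits.

(* Main.v *)
Require Import Defs.
From mathcomp Require Import all_boot all_algebra.
From mathcomp Require Import boolp classical_sets.

(** Prime ideals are exactly the complements of divisor-closed submonoids, and
    a non-invertible [b] is quasi-atomic precisely when it divides an element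
    of the submonoid generated by the atoms, that is, when it lies in the
    divisor closure [D] of that submonoid.

    If every non-invertible element lies in [D] and [P] is a nonempty prime
    ideal, then [P] has a non-invertible element, hence meets the submonoid
    generated by the atoms; as the complement of [P] is a submonoid, it cannot
    contain all the atoms ([prime_ideal_meets_generators]).  Conversely, the
    complement of [D] is a prime ideal without atoms
    ([nondivisors_prime_ideal]), so it must be empty. *)

Set Implicit Arguments.
Unset Strict Implicit.

Import GRing.Theory.

Local Open Scope classical_set_scope.
Local Open Scope ring_scope.

Lemma gen_submonoid_is_submonoid (M : nmodType) (S : set M) :
  is_submonoid (gen_submonoid S).
Proof.
split=> [T [[T0 _] _] // | x y Sx Sy T TS].
have [[_ TD] _] := TS.
by apply: TD; [apply: Sx | apply: Sy].
Qed.

Lemma sub_gen_submonoid (M : nmodType) (S : set M) : S `<=` gen_submonoid S.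
Proof. by move=> x Sx T [_]; apply. Qed.

Lemma ideal_addr (M : nmodType) (I : set M) (r s : M) :
  is_ideal I -> I r -> I (r + s).
Proof. by move=> idI Ir; apply: idI; exists r => //; exists s. Qed.

Lemma prime_ideal_not_invertible (M : nmodType) (P : set M) (b : M) :
  is_prime_ideal P -> P b -> ~ invertible M b.
Proof.
move=> [idP properP _] Pb [v bv0]; apply: properP.
apply/seteqP; split=> x // _.
by rewrite -[x]add0r -bv0 -addrA; apply: ideal_addr.
Qed.

Lemma prime_ideal_setC_submonoid (M : nmodType) (P : set M) :
  is_prime_ideal P -> is_submonoid (~` P).
Proof.
move=> primeP; split=> [P0 | x y nPx nPy Pxy].
  by apply: (prime_ideal_not_invertible primeP P0); exists 0; rewrite addr0.
by case: primeP => _ _ /(_ x y Pxy) [].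
Qed.

(** Otherwise [S] would lie in the complement of [P], which is a submonoid and
    so would contain everything that [S] generates. *)
Lemma prime_ideal_meets_generators (M : nmodType) (P S : set M) (x : M) :
  is_prime_ideal P -> P x -> gen_submonoid S x -> exists a, S a /\ P a.
Proof.
move=> primeP Px genSx; apply: contrapT => noSP.
apply: (genSx (~` P)) Px; split; first exact: prime_ideal_setC_submonoid.
by move=> a Sa Pa; apply: noSP; exists a.
Qed.

(** Divisors of elements of a submonoid form a divisor-closed submonoid, whose
    complement is therefore prime; it is proper because it misses [0]. *)
Lemma nondivisors_prime_ideal (M : nmodType) (N : set M) :
  is_submonoid N -> is_prime_ideal [set x | ~ exists m, N (x + m)].
Proof.
move=> [N0 ND]; split.
- by move=> _ [r ndr [s _ <-]] [m Nm]; apply: ndr; exists (s + m); rewrite addrA.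
- move=> eqT; have : [set: M] 0 by [].
  by rewrite -eqT; apply; exists 0; rewrite addr0.
- move=> r s ndrs; apply/not_andP => -[[m Nrm] [n Nsn]].
  by apply: ndrs; exists (m + n); rewrite addrACA; apply: ND.
Qed.

Theorem theorem4p9 (M : nmodType) (cancelM : cancellative M) :
  quasi_atomic M <->
  (forall P : set M, is_prime_ideal P -> P !=set0 ->
     exists a : M, atoms M a /\ P a).
Proof.
split=> [qaM P primeP [b Pb] | primeM b nub].
  have [_ [m genbm]] := qaM b (prime_ideal_not_invertible primeP Pb).
  apply: (prime_ideal_meets_generators primeP _ genbm).
  by case: primeP => idP _ _; apply: ideal_addr.
split=> //; apply: contrapT => ndb.
have primeD :=
  nondivisors_prime_ideal (gen_submonoid_is_submonoid (atoms M)).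
have [|a [atom_a]] := primeM _ primeD; first by exists b.
by apply; exists 0; rewrite addr0; apply: sub_gen_submonoid.
Qed.
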